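(* If an equation $\varepsilon$ fails in a compatible surjection, then it fails in a diagram based on a chain of size up to $|\Delta_\varepsilon|$.
   Context: Write $x^{(0)}=x$, $x^{(m)}=x^{\ell^m}$ and $x^{(-m)}=x^{r^m}$ for $m\in\mathbb{Z}^+$. The equation $\varepsilon$ over variables $x_1,\ldots,x_n$ is in intentional form $1\leq w_1\vee\cdots\vee w_k$, where each $w_j$ is a (possibly empty) product of terms $x_i^{(m)}$. Terms are taken in the language of intentional terms expanded by two constants $+$ and $-$. $FS_\varepsilon$ is the set of final subwords $u$ of the $w_j$ ($w_j=vu$), including $1$. For a variable $x$, $m\in\mathbb{N}$, $v\in FS_\varepsilon$: $\Delta^v_{x,m}=\{v\}\cup\bigcup_{j=0}^m\{\sigma_jx^{(j)}\cdots\sigma_mx^{(m)}v:\sigma_j,\ldots,\sigma_m\in\{-1,0\},\sigma_0=0\}$ and $\Delta^v_{x,-m}=\{v\}\cup\bigcup_{j=0}^m\{\sigma_jx^{(-j)}\cdots\sigma_mx^{(-m)}v:\sigma_j,\ldots,\sigma_m\in\{1,0\},\sigma_0=0\}$ ($\sigma=-1$: factor $-$; $\sigma=1$: factor $+$; $\sigma=0$: no factor). $S_\varepsilon=\{(i,m,v): x_i^{(m)}v\in FS_\varepsilon, v\in FS_\varepsilon\}$ and $\Delta_\varepsilon=\{1\}\cup\bigcup_{(i,m,v)\in S_\varepsilon}\Delta^v_{x_i,m}$ (finite). A c-chain is a triple $(\Delta,\leq,\lessdot)$ with $(\Delta,\leq)$ a finite chain and $\lessdot$ a subset of its covering relation $\prec$.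 For an order-preserving partial function $g$ on it: $(x,b)\in g^{[\ell]}$ iff $b\in Dom(g)$ and some $a\in Dom(g)$ has $a\lessdot b$ and $g(a)<x\leq g(b)$; $(x,a)\in g^{[r]}$ iff $a\in Dom(g)$ and some $b\in Dom(g)$ has $a\lessdot b$ and $g(a)\leq x<g(b)$; $g^{[0]}=g$, $g^{[k+1]}=(g^{[k]})^{[\ell]}$, $g^{[-(k+1)]}=(g^{[-k]})^{[r]}$. $\mathbf{Pf}(\mathbf{\Delta})$ is the algebra of order-preserving partial functions on the c-chain under composition, $^{[\ell]}$, $^{[r]}$ and the identity. A diagram $(\mathbf{\Delta},f_1,\ldots,f_n)$ is a finite c-chain with order-preserving partial functions $f_1,\ldots,f_n$ on it; $\varepsilon$ fails in it if there is a homomorphism $\psi$ from intentional terms to $\mathbf{Pf}(\mathbf{\Delta})$ (preserving multiplication, $1$ and the inverses) with $\psi(x_i)=f_i$ and a point $p$ with $\psi(1)(p)>\psi(w_j)(p)$ for all $j$. A compatible surjection for $\varepsilon$ is an onto map $\varphi:\Delta_\varepsilon\to\mathbb{N}_q=\{1,\ldots,q\}$ such that: (i) each $g_i:=\{(\varphi(u),\varphi(x_iu)):u,x_iu\in\Delta_\varepsilon\}$ is an order-preserving partial function; (ii) $\lessdot:=\{(\varphi(v),\varphi(+v)):v,+v\in\Delta_\varepsilon\}\cup\{(\varphi(-v),\varphi(v)):v,-v\in\Delta_\varepsilon\}$ is contained in the covering relation of $\mathbb{N}_q$; (iii) $\varphi(x_i^{(m)}u)=g_i^{[m]}(\varphi(u))$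 whenever $u,x_i^{(m)}u\in\Delta_\varepsilon$, computed in $(\mathbb{N}_q,\leq,\lessdot)$. $\varepsilon$ fails in $\varphi$ if $\varphi(w_j)<\varphi(1)$ for all $j$. *)

(* Defs.v *)
From HB Require Import structures.
From mathcomp Require Import all_boot all_order all_algebra.

Set Implicit Arguments.
Unset Strict Implicit.
Unset Printing Implicit Defensive.

Import Order.TTheory GRing.Theory.

Local Open Scope order_scope.

(** Partial functions are given by their graphs, finite sets of pairs
    (argument, value). *)

Section Graphs.
Context {d : Order.disp_t} {T : finOrderType d}.
Implicit Types (g h dot : {set T * T}) (a b : T).

Definition covers a b : bool := (a < b) && [forall c, ~~ (a < c < b)].

Definition order_pfun g : bool :=
  [forall p in g, forall q in g,
     ((p.1 == q.1) ==> (p.2 == q.2)) && ((p.1 <= q.1) ==> (p.2 <= q.2))].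

Definition gid : {set T * T} := [set p | p.1 == p.2].

(* [gcomp g h] is g after h. *)
Definition gcomp g h : {set T * T} :=
  [set p | [exists c, ((p.1, c) \in h) && ((c, p.2) \in g)]].

Definition glinv dot g : {set T * T} :=
  [set p | let x := p.1 in let b := p.2 in
     [exists a, exists ga, exists gb,
       [&& (a, ga) \in g, (b, gb) \in g, (a, b) \in dot, ga < x & x <= gb]]].

Definition grinv dot g : {set T * T} :=
  [set p | let x := p.1 in let a := p.2 in
     [exists b, exists ga, exists gb,
       [&& (a, ga) \in g, (b, gb) \in g, (a, b) \in dot, ga <= x & x < gb]]].

(* Recall that [Negz k] is -(k+1). *)
Definition giter dot g (m : int) : {set T * T} :=
  match m with
  | Posz k => iter k (glinv dot) g
  | Negz k => iter k.+1 (grinv dot) g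
  end.

Lemma order_pfunP g :
  reflect (forall x y x' y', (x, y) \in g -> (x', y') \in g ->
             (x = x' -> y = y') /\ (x <= x' -> y <= y'))
          (order_pfun g).
Proof.
apply: (iffP idP) => [/'forall_implyP gP x y x' y' xy xy'|gP].
  have /'forall_implyP /(_ _ xy') /= := gP _ xy.
  by case/andP=> /implyP f /implyP m; split=> // /eqP /f /eqP.
apply/'forall_implyP=> -[x y] xy; apply/'forall_implyP=> -[x' y'] xy' /=.
have [f m] := gP _ _ _ _ xy xy'.
by apply/andP; split; apply/implyP=> // /eqP /f /eqP.
Qed.

(* A monotone relation is functional, by antisymmetry. *)
Lemma order_pfun_mono g :
  (forall x y x' y', (x, y) \in g -> (x', y') \in g -> x <= x' -> y <= y') ->
  order_pfun g.
Proof.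
move=> gP; apply/order_pfunP => x y x' y' xy xy'; split; last exact: gP.
by move=> e; apply/le_anti/andP; split; [apply: gP xy xy' _|apply: gP xy' xy _];
  rewrite e.
Qed.

Lemma gid_order_pfun : order_pfun gid.
Proof.
by apply: order_pfun_mono => x y x' y'; rewrite !inE /= => /eqP-> /eqP->.
Qed.

Lemma gcomp_order_pfun g h :
  order_pfun g -> order_pfun h -> order_pfun (gcomp g h).
Proof.
move=> /order_pfunP gP /order_pfunP hP; apply: order_pfun_mono => x y x' y'.
rewrite !inE /= => /existsP[c /andP[xc cy]] /existsP[c' /andP[xc' cy']] le_xx'.
by have [_ /(_ le_xx') /(proj2 (gP _ _ _ _ cy cy'))] := hP _ _ _ _ xc xc'.
Qed.

Lemma covers_le a b c : covers a b -> c < b -> c <= a.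
Proof.
case/andP=> _ /forallP /(_ c); rewrite leNgt => + cb.
by rewrite cb andbT.
Qed.

Lemma glinv_order_pfun dot g : (forall a b, (a, b) \in dot -> covers a b) ->
  order_pfun g -> order_pfun (glinv dot g).
Proof.
move=> dotP /order_pfunP gP; apply: order_pfun_mono => x b x' b'.
rewrite !inE /= => /existsP[a /existsP[ga /existsP[gb /and5P[Ga _ ab ax _]]]].
case/existsP=> [a' /existsP[ga' /existsP[gb' /and5P[_ Gb' _ _ xb']]]] le_xx'.
rewrite leNgt; apply/negP => /(covers_le (dotP _ _ ab)).
move/(proj2 (gP _ _ _ _ Gb' Ga)); rewrite leNgt.
by rewrite (lt_le_trans ax (le_trans le_xx' xb')).
Qed.

Lemma grinv_order_pfun dot g : (forall a b, (a, b) \in dot -> covers a b) ->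
  order_pfun g -> order_pfun (grinv dot g).
Proof.
move=> dotP /order_pfunP gP; apply: order_pfun_mono => x a x' a'.
rewrite !inE /= => /existsP[b /existsP[ga /existsP[gb /and5P[Ga _ _ ax _]]]].
case/existsP=> [b' /existsP[ga' /existsP[gb' /and5P[_ Gb' ab' _ xb']]]] le_xx'.
rewrite leNgt; apply/negP => lt_a'a.
have : b' <= a.
  rewrite leNgt; apply/negP => lt_ab'.
  by have := covers_le (dotP _ _ ab') lt_ab'; rewrite leNgt lt_a'a.
move/(proj2 (gP _ _ _ _ Gb' Ga)) => le_gb'a.
by have := lt_le_trans (le_lt_trans le_xx' xb') (le_trans le_gb'a ax); rewrite ltxx.
Qed.

End Graphs.

Record cchain := CChain {
  cc_disp : Order.disp_t;
  cc_points :> finOrderType cc_disp;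
  lessdot : {set cc_points * cc_points};
  lessdotP : forall a b, (a, b) \in lessdot -> covers a b }.

Record pf (C : cchain) :=
  Pf { graph :> {set C * C}; graphP : order_pfun graph }.

HB.instance Definition _ C := [isSub for @graph C].

Section PfAlgebra.
Context {C : cchain}.
Implicit Types f g : pf C.

Definition pf_one : pf C := Pf gid_order_pfun.
Definition pf_mul f g : pf C := Pf (gcomp_order_pfun (graphP f) (graphP g)).
Definition pf_linv f : pf C :=
  Pf (glinv_order_pfun (@lessdotP C) (graphP f)).
Definition pf_rinv f : pf C :=
  Pf (grinv_order_pfun (@lessdotP C) (graphP f)).

End PfAlgebra.

(* [TLinv] and [TRinv] are the operations ^l and ^r. *)
Inductive iterm (n : nat) :=
  | TVar of 'I_n
  | TOne
  | TMul of iterm n & iterm n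
  | TLinv of iterm n
  | TRinv of iterm n.
Arguments TOne {n}.

Definition tpow n (t : iterm n) (m : int) : iterm n :=
  match m with
  | Posz k => iter k (@TLinv n) t
  | Negz k => iter k.+1 (@TRinv n) t
  end.

(* The pair [(i, m)] stands for x_i^(m). *)
Definition iword (n : nat) := seq ('I_n * int).

Definition term_of_iword n (w : iword n) : iterm n :=
  foldr (fun a t => TMul (tpow (TVar a.1) a.2) t) TOne w.

Definition iterm_hom n (C : cchain) (psi : iterm n -> pf C) : Prop :=
  [/\ psi TOne = pf_one,
      forall s t, psi (TMul s t) = pf_mul (psi s) (psi t),
      forall t, psi (TLinv t) = pf_linv (psi t)
    & forall t, psi (TRinv t) = pf_rinv (psi t)].

(* The nonempty tuple [w_1, ..., w_k] stands for 1 <= w_1 \/ ... \/ w_k. *)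
Definition equation (n k : nat) := k.+1.-tuple (iword n).

Record diagram (n : nat) := Diagram {
  dg_chain :> cchain;
  dg_fun : 'I_n -> pf dg_chain }.

Definition fails_in_diagram n k (eps : equation n k) (D : diagram n) : Prop :=
  exists2 psi : iterm n -> pf D,
    iterm_hom psi /\ (forall i, psi (TVar i) = dg_fun D i) &
    exists p : D, forall w, w \in eps ->
      exists y1 yw : D, [/\ (p, y1) \in graph (psi TOne),
        (p, yw) \in graph (psi (term_of_iword w)) & yw < y1].

(* [Pow i m] is x_i^(m); [Plus] and [Minus] are the constants + and -. *)
Inductive letter (n : nat) :=
  | Pow of 'I_n & int
  | Plus
  | Minus.
Arguments Plus {n}.
Arguments Minus {n}.

Definition letter_code n (a : letter n) : 'I_n * int + bool :=
  match a with
  | Pow i m => inl (i, m)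
  | Plus => inr true
  | Minus => inr false
  end.

Definition letter_decode n (c : 'I_n * int + bool) : letter n :=
  match c with
  | inl (i, m) => Pow i m
  | inr true => Plus
  | inr false => Minus
  end.

Lemma letter_codeK n : cancel (@letter_code n) (@letter_decode n).
Proof. by case. Qed.

HB.instance Definition _ n :=
  Equality.copy (letter n) (can_type (@letter_codeK n)).

Definition word (n : nat) := seq (letter n).

Definition word_of_iword n (w : iword n) : word n :=
  [seq Pow a.1 a.2 | a <- w].

Section DeltaEps.
Context {n : nat}.
Implicit Types (eps : seq (iword n)) (i : 'I_n) (m : int) (v : iword n).

Definition FS eps : seq (iword n) :=
  undup ([::] :: [seq drop j w | w <- eps, j <- iota 0 (size w).+1]).

Definition Seps eps : seq ('I_n * int * iword n) :=
  pmap (fun u => if u is (i, m) :: v then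
                   if v \in FS eps then Some (i, m, v) else None
                 else None) (FS eps).

(* The word sigma_j x^(e j) ... sigma_M x^(e M) v, where a true bit of [sigma]
   stands for the letter [c] and a false one for no letter. *)
Definition signed_word i (c : letter n) (e : nat -> int) (M j : nat)
    (sigma : M.+1.-tuple bool) v : word n :=
  flatten [seq nseq (nth false sigma s) c ++ [:: Pow i (e s)]
          | s <- iota j (M.+1 - j)]
  ++ word_of_iword v.

Definition Delta_gen i (c : letter n) (e : nat -> int) (M : nat) v
    : seq (word n) :=
  word_of_iword v ::
  [seq signed_word i c e j sigma v
  | j <- iota 0 M.+1,
    sigma <- [seq sigma <- enum {: M.+1.-tuple bool} | ~~ tnth sigma ord0]].

Definition Delta_xmv i m v : seq (word n) :=
  match m with
  | Posz M => Delta_gen i Minus Posz M v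
  | Negz k => Delta_gen i Plus (fun s => - Posz s)%R k.+1 v
  end.

Definition Delta eps : seq (word n) :=
  undup ([::] :: flatten [seq Delta_xmv t.1.1 t.1.2 t.2 | t <- Seps eps]).

(** A map phi from Delta eps to the chain {1, ..., q}, the latter represented
    by ['I_q]; the values of [phi] outside [Delta eps] are never used. *)

Section Surjection.
Context (eps : seq (iword n)) {q : nat} (phi : word n -> 'I_q).

Definition sgraph (i : 'I_n) : {set 'I_q * 'I_q} :=
  [set p in [seq (phi u, phi (Pow i 0%R :: u))
            | u <- Delta eps & Pow i 0%R :: u \in Delta eps]].

Definition sdot : {set 'I_q * 'I_q} :=
  [set p in [seq (phi u, phi (Plus :: u))
            | u <- Delta eps & Plus :: u \in Delta eps]] :|:
  [set p in [seq (phi (Minus :: u), phi u)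
            | u <- Delta eps & Minus :: u \in Delta eps]].

Definition compatible_surjection : Prop :=
  [/\ forall c : 'I_q, exists2 u, u \in Delta eps & phi u = c,
      forall i, order_pfun (sgraph i),
      forall a b, (a, b) \in sdot -> covers a b
    & forall i m u, u \in Delta eps -> Pow i m :: u \in Delta eps ->
        (phi u, phi (Pow i m :: u)) \in giter sdot (sgraph i) m].

Definition fails_in_surjection : Prop :=
  forall w, w \in eps -> phi (word_of_iword w) < phi [::].

End Surjection.

End DeltaEps.

(* Main.v *)
Require Import Defs.
From mathcomp Require Import all_boot all_order all_algebra.

(** The diagram is the chain [N_q] itself, with the relation [sdot] and the
    partial functions [sgraph i].  Since all final subwords of the [w_j] belong
    to [Delta eps], condition (iii) of compatibility can be iterated along
    [w_j], so that [w_j] evaluates at [phi 1] to [phi w_j], which is below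
    [phi 1]. *)

Set Implicit Arguments.
Unset Strict Implicit.
Unset Printing Implicit Defensive.

Section Evaluation.
Context {n : nat} {C : cchain} (f : 'I_n -> pf C).

Fixpoint term_eval (t : iterm n) : pf C :=
  match t with
  | TVar i => f i
  | TOne => pf_one
  | TMul s t => pf_mul (term_eval s) (term_eval t)
  | TLinv t => pf_linv (term_eval t)
  | TRinv t => pf_rinv (term_eval t)
  end.

Lemma term_eval_hom : iterm_hom term_eval.
Proof. by []. Qed.

(** Carries condition (iii), stated with [giter], over to values of terms. *)
Lemma graph_term_eval_tpow (t : iterm n) (m : int) :
  graph (term_eval (tpow t m)) = giter (@lessdot C) (graph (term_eval t)) m.
Proof.
case: m => k /=; first by elim: k => //= k ->.
by congr grinv; elim: k => //= k ->.
Qed.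

End Evaluation.

Section FinalSubwords.
Context {n : nat}.
Implicit Types (eps : seq (iword n)) (v w : iword n).

Lemma mem_FS_cat eps v w : v ++ w \in eps -> w \in FS eps.
Proof.
move=> vw; rewrite mem_undup inE; apply/orP; right.
apply/allpairsPdep; exists (v ++ w), (size v).
by rewrite drop_size_cat // mem_iota size_cat /= add0n ltnS leq_addr.
Qed.

(* Take [j = m] in [Delta_gen], where the sign [sigma_m] is trivial. *)
Lemma mem_Delta_gen (i : 'I_n) (c : letter n) (e : nat -> int) (M : nat) v :
  Pow i (e M) :: word_of_iword v \in Delta_gen i c e M v.
Proof.
rewrite inE; apply/orP; right; apply/allpairsPdep.
exists M, (nseq_tuple M.+1 false); split.
- by rewrite mem_iota /= ltnSn.
- by rewrite mem_filter mem_enum andbT (tnth_nth false).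
- rewrite /signed_word subSnn /=.
  by rewrite -[_ :: nseq M _]/(nseq M.+1 _) nth_nseq if_same.
Qed.

(** If [w] begins with x_i^(m), both [w] and its tail are final subwords, so they yield a triple of
    [Seps eps], whose [Delta_xmv] contains [w]. *)
Lemma mem_Delta eps v w : v ++ w \in eps -> word_of_iword w \in Delta eps.
Proof.
move=> vw; rewrite mem_undup inE.
case: w vw => [|[i m] w] vw; first by rewrite eqxx.
apply/orP; right; apply/flattenP.
(* For [m = Negz k] the last exponent [- Posz k.+1] computes to [Negz k]. *)
exists (Delta_xmv i m w); last by case: m {vw} => k; apply: mem_Delta_gen.
apply/mapP; exists (i, m, w) => //.
have wFS : w \in FS eps.
  by apply: (@mem_FS_cat _ (rcons v (i, m))); rewrite cat_rcons.
rewrite mem_pmap; apply/mapP; exists ((i, m) :: w); last by rewrite wFS.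
exact: mem_FS_cat vw.
Qed.

End FinalSubwords.

Lemma card_compatible_surjection (n : nat) (eps : seq (iword n)) (q : nat)
    (phi : word n -> 'I_q) :
  compatible_surjection eps phi -> (q <= size (Delta eps))%N.
Proof.
case=> phi_onto _ _ _; rewrite -(size_map phi) -[leqLHS]size_enum_ord.
apply: uniq_leq_size (enum_uniq _) _ => c _.
by have [u u_Delta <-] := phi_onto c; apply: map_f.
Qed.

Theorem theorem3p6 (n k : nat) (eps : equation n k) (q : nat)
    (phi : word n -> 'I_q) :
  compatible_surjection eps phi -> fails_in_surjection eps phi ->
  exists D : diagram n,
    (#|{: D}| <= size (Delta eps))%N /\ fails_in_diagram eps D.
Proof.
move=> phi_compat phi_fails.
have [_ g_pfun dotP phi_pow] := phi_compat.
pose C := CChain dotP.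
pose f i : pf C := @Pf C _ (g_pfun i).
exists (Diagram f); split.
  by rewrite /= card_ord; apply: card_compatible_surjection phi_compat.
exists (term_eval f); first by split=> //; apply: term_eval_hom.
exists (phi [::]) => w w_eps; exists (phi [::]), (phi (word_of_iword w)).
split; [by rewrite inE /= | | exact: phi_fails].
have: [::] ++ w \in eps by [].
(* A tail of w_j need not be in [eps], so the induction keeps the prefix [v] already removed. *)
move: [::] => v; elim: w v {w_eps} => [|[i m] w IHw] v vw.
  by rewrite inE /=.
have vw' : rcons v (i, m) ++ w \in eps by rewrite cat_rcons.
(* The tail acts first: it sends [phi [::]] to this point, and x_i^(m) is then applied there. *)
rewrite inE /=; apply/existsP; exists (phi (word_of_iword w)).
rewrite (IHw _ vw') graph_term_eval_tpow /=.
by apply: phi_pow; [apply: mem_Delta vw' | apply: mem_Delta vw].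
Qed.
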